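(* The (control-dependent) dynamics for $X$ is given, for almost every $t$, by $$X'=\frac{[Z_u,X]}{\langle Z_u,X\rangle}.$$
   Context: For $A,B\in\mathfrak{sl}_2(\mathbb{R})$ write $\langle A,B\rangle=\mathrm{trace}(AB)$ and $[A,B]=AB-BA$. For $p,q\in\mathbb{R}^2$, $p\wedge q$ is the determinant of the matrix with columns $p,q$; $e_j^*=(\cos(\pi j/3),\sin(\pi j/3))$. Setting: $g:[0,t_f]\to\mathrm{SL}_2(\mathbb{R})$ is a $C^1$ curve with $g'=gX$, where $X:[0,t_f]\to\mathfrak{sl}_2(\mathbb{R})$ is Lipschitz (hence differentiable almost everywhere), parameterized so that $\det X(t)=1$ for all $t$. (It comes from a parameterization $\sigma_j(t)=g(t)e_{2j}^*$ of the boundary of a convex centrally symmetric disc.) Writing $X=\begin{pmatrix}a&b\\ c&-a\end{pmatrix}$, the star conditions $\sqrt3|a|<c$ and $3b+c<0$ hold for all $t$. The state-dependent curvatures $v_j=e_{2j}^*\wedge(X+X^{-1}X')e_{2j}^*$, $j=0,1,2$, satisfy $v_j\ge0$ almost everywhere, and $v:=v_0+v_1+v_2>0$. The controls are $u_j=v_j/v$, $j=0,1,2$ (so $u_j\geq 0$ and $u_0+u_1+u_2=1$), and $$Z_u=\begin{pmatrix}\frac{u_1-u_2}{\sqrt3}&\frac{u_0-2u_1-2u_2}{3}\\ u_0&\frac{u_2-u_1}{\sqrt3}\end{pmatrix}\in\mathfrak{sl}_2(\mathbb{R}),$$ which satisfies $u_j=e_{2j}^*\wedge Z_ue_{2j}^*$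 for $j=0,1,2$. *)

(* Defs.v *)
From HB Require Import structures.
From mathcomp Require Import all_boot all_order all_algebra.
From mathcomp Require Import all_classical all_reals all_analysis.

Set Implicit Arguments.
Unset Strict Implicit.
Unset Printing Implicit Defensive.

Import Order.TTheory GRing.Theory Num.Theory.
Import numFieldNormedType.Exports.

Local Open Scope classical_set_scope.
Local Open Scope ring_scope.

Section Matrices.
Variable R : realType.
Implicit Types (p q : 'cV[R]_2) (A B M : 'M[R]_2).

Definition mat2 (a b c d : R) : 'M[R]_2 :=
  \matrix_(i, j) if i == 0 then (if j == 0 then a else b)
                 else (if j == 0 then c else d).

Definition SL2 : set 'M[R]_2 := [set M | \det M = 1].

Definition sl2 : set 'M[R]_2 := [set M | \tr M = 0].

Definition pairing A B : R := \tr (A *m B).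

Definition bracket A B : 'M[R]_2 := A *m B - B *m A.

Definition wedge p q : R := \det (row_mx p q : 'M[R]_2).

Definition e_star (j : nat) : 'cV[R]_2 :=
  \col_i if i == 0 then cos (pi * j%:R / 3) else sin (pi * j%:R / 3).

Definition star_conditions M : Prop :=
  Num.sqrt 3 * `|M 0 0| < M 1 0 /\ 3 * M 0 1 + M 1 0 < 0.

(* The trace-free matrix [Z] with
   [wedge (e_star R (2 * j)) (Z *m e_star R (2 * j)) = u j] for [j = 0, 1, 2]. *)
Definition control_matrix (u : nat -> R) : 'M[R]_2 :=
  mat2 ((u 1%N - u 2%N) / Num.sqrt 3)
       ((u 0%N - 2 * u 1%N - 2 * u 2%N) / 3)
       (u 0%N)
       ((u 2%N - u 1%N) / Num.sqrt 3).

End Matrices.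

Section Curves.
Variable R : realType.

(* Derivative of [f] at [t] relative to [D]; on a closed interval it is the
   one-sided derivative at the endpoints, so the values of [f] outside of the
   interval are irrelevant. *)
Definition has_derivative_in (D : set R) (f : R -> 'M[R]_2) (t : R)
    (l : 'M[R]_2) : Prop :=
  (s - t)^-1 *: (f s - f t) @[s --> within D t^'] --> l.

Definition C1_on (D : set R) (f df : R -> 'M[R]_2) : Prop :=
  (forall t, D t -> has_derivative_in D f t (df t)) /\
  {within D, continuous df}.

Variable X : R -> 'M[R]_2.

(* The quantities below depend on [derive1 X t], hence are meaningful only at points
   where [X] is derivable. *)

Definition curvature (j : nat) (t : R) : R :=
  wedge (e_star R (2 * j)%N) ((X t + invmx (X t) *m derive1 X t) *m e_star R (2 * j)%N).

Definition total_curvature (t : R) : R := \sum_(j < 3) curvature j t.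

Definition control (t : R) (j : nat) : R := curvature j t / total_curvature t.

End Curves.

(* Main.v *)
Require Import Defs.
From HB Require Import structures.
From mathcomp Require Import all_boot all_order all_algebra.
From mathcomp Require Import all_classical all_reals all_analysis.
From mathcomp Require Import ring lra.

Set Implicit Arguments.
Unset Strict Implicit.
Unset Printing Implicit Defensive.

Import Order.TTheory GRing.Theory Num.Theory.
Import numFieldNormedType.Exports.

Local Open Scope classical_set_scope.
Local Open Scope ring_scope.

(** The equation is an algebraic identity that holds at every interior [t] where
    [X] is derivable and the total curvature is positive, so the proof has an
    algebraic and a measure-theoretic part.

    Algebra.  Two matrices of [sl2] satisfy [A B + B A = tr(A B) I], so
    [X^2 = - I] and [X^-1 = - X].  Differentiating [tr X = 0] and [det X = 1]
    gives [tr X' = 0] and [tr(X X') = 0], whence [X X' = - X' X].  In particular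
    [Y = X + X^-1 X' = X - X X'] has trace zero.  A trace-free matrix is
    determined by its quadratic form [e |-> e ^ Y e], a form in two variables,
    hence by the values of this form at the three vectors [e_star (2 * j)];
    [control_matrix] inverts this correspondence ([control_matrix_wedge]).  The
    curvatures being these values, the matrix of the control is
    [v^-1 (X - X X')] with [v] the total curvature
    ([control_matrix_control]).  From [X X' X = X'] one gets
    [[Y, X] = - 2 X'] and [<Y, X> = - 2], and the factor [v^-1] cancels in the
    quotient ([control_dynamics]).

    Measure theory.  That [X] is derivable almost everywhere is Rademacher's
    theorem on the line ([derivable_ae_lipschitz_mx]).  Adding a large multiple
    of the identity makes a real Lipschitz function nondecreasing.  Its
    Stieltjes measure is then at most a multiple of Lebesgue measure, so by
    Radon-Nikodym the function is, up to a constant, the primitive of an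
    integrable density, and Lebesgue's differentiation theorem applies. *)

(** * Rademacher's theorem on the line *)

Section Rademacher.
Context {R : realType}.
Local Notation mu := (@lebesgue_measure R).

(** The comparison of increments is one of the two measures on half-open
    intervals; it passes to every set because both measures are infima over
    the same covers by half-open intervals. *)
Lemma stieltjes_measure_le_lebesgue (h : cumulative R R) (L : R) :
  0 < L -> (forall x y, x <= y -> h y - h x <= L * (y - x)) ->
  forall A, (lebesgue_stieltjes_measure h A <= L%:E * mu A)%E.
Proof.
move=> L0 hL A; rewrite -lee_pdivrMl//.
apply: le_ereal_inf_tmp => _ /= [F [mF AF] <-].
rewrite lee_pdivrMl// -nneseriesZl//.
apply: (@le_trans _ _ (\sum_(k <oo) wlength h (F k))%E).
  by apply: ereal_inf_lbound; exists F.
apply: lee_nneseries => // k _.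
have [[x y] /= _ <-] := mF k.
have [xy|yx] := leP x y.
  by rewrite !wlength_itv_bnd// -EFinM lee_fin hL.
by rewrite set_itv_ge ?wlength0 ?mule0// -leNgt /= bnd_simp ltW.
Qed.

(** The Stieltjes measure of [h] is restricted to [`]a, b]] because the
    Radon-Nikodym theorem is applied to a finite measure.  On the open interval,
    [h] and the primitive of the density differ by the constant [h a]. *)
Lemma derivable_ae_cumulative (h : cumulative R R) (L a b : R) :
  0 < L -> a < b -> (forall x y, x <= y -> h y - h x <= L * (y - x)) ->
  {ae mu, forall x, x \in `]a, b[ -> derivable h x 1}.
Proof.
move=> L0 ab hL.
have lsE x y : x <= y -> lebesgue_stieltjes_measure h `]x, y] = (h y - h x)%:E.
  move=> xy; rewrite /lebesgue_stieltjes_measure/= /measure_extension.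
  rewrite measurable_mu_extE//=; last exact: is_ocitv.
  by rewrite wlength_itv_bnd.
have mab : measurable (`]a, b]%classic : set (measurableTypeR R)).
  exact: measurable_itv.
have nuoo : (lebesgue_stieltjes_measure h `]a, b] < +oo)%E.
  by rewrite lsE ?ltry// ltW.
pose nu : {finite_measure set _ -> \bar R} := mfrestr mab nuoo.
have numu : nu `<< mu.
  apply/null_content_dominatesP => A mA muA0.
  apply/eqP; rewrite eq_le measure_ge0 andbT.
  apply: (le_trans (stieltjes_measure_le_lebesgue L0 hL (A `&` `]a, b]))).
  have : (mu (A `&` `]a, b]) <= 0)%E.
    by rewrite -muA0; apply: le_measure; rewrite ?inE//; exact: measurableI.
  by move=> H; rewrite pmule_rle0.
have [phi [phi0 phifin phiint phiE]] := radon_nikodym_sigma_finite numu.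
pose f := fine \o phi.
have fE : EFin \o f = phi by apply/funext => x /=; rewrite /f/= fineK.
have fint : mu.-integrable setT (EFin \o f) by rewrite fE.
have locf : locally_integrable setT f.
  by apply: open_integrable_locally => //; exact: openT.
have := @FTC1 R f (BRight a) _ locf.
have intf y : mu.-integrable [set` Interval (BRight a) (BRight y)] (EFin \o f).
  by apply: integrableS fint => //; exact: measurable_itv.
move=> /(_ intf) aeF.
apply: (@filterS _ _ (ae_filter_ringOfSetsType mu) _ _ _ aeF) => x Fx.
move=> xab; have /andP[ax xb] : a < x < b by move: xab; rewrite in_itv.
have [dF _] := Fx ax.
set F := (X in derivable X _ _) in dF.
have hF y : y \in `]a, b[ -> h y = F y + h a.
  rewrite in_itv/= => /andP[ay yb].
  rewrite /F /Rintegral.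
  under eq_integral do rewrite -[(f _)%:E]/((EFin \o f) _) fE.
  rewrite -phiE; last exact: measurable_itv.
  rewrite /nu/= /mfrestr /mrestr setIidl; last first.
    by move=> z/=; rewrite !in_itv/= => /andP[-> /le_trans]; apply; exact: ltW.
  by rewrite lsE ?ltW//= subrK.
apply: (@near_eq_derivable _ _ _ (fun y => F y + h a)).
  by near=> y; rewrite (hF y)//; near: y; exact: near_in_itvoo.
by apply: derivableD => //; exact: derivable_cst.
Unshelve. all: by end_near. Qed.

(** Reduction to [derivable_ae_cumulative]: [f] is extended to the line by
    composing it with the projection [c] onto [[a, b]], which is nondecreasing
    and 1-Lipschitz, and the term [K * x] then makes the sum nondecreasing. *)
Lemma derivable_ae_lipschitz (f : R -> R) (a b k : R) :
  a < b ->
  (forall x y, x \in `[a, b] -> y \in `[a, b] -> `|f x - f y| <= k * `|x - y|) ->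
  {ae mu, forall x, x \in `]a, b[ -> derivable f x 1}.
Proof.
move=> ab flip.
pose c (x : R) := Num.max a (Num.min x b).
have cab x : c x \in `[a, b].
  by rewrite in_itv/= le_max lexx ge_max (ltW ab) ge_min lexx orbT.
have cid x : x \in `[a, b] -> c x = x.
  by rewrite in_itv/= => /andP[ax xb]; rewrite /c (min_idPl xb) (max_idPr ax).
have c_nd x y : x <= y -> 0 <= c y - c x <= y - x.
  by move=> xy; rewrite /c /Num.max /Num.min; do ! case: ifPn; lra.
(* [k] itself need not be positive. *)
pose K := `|k| + 1.
have K0 : 0 < K by rewrite ltr_wpDl.
have fK x y : x <= y -> `|f (c y) - f (c x)| <= K * (c y - c x).
  move=> /c_nd /andP[xy _]; apply: (le_trans (flip _ _ (cab y) (cab x))).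
  rewrite [X in _ * X]ger0_norm// ler_wpM2r//.
  by rewrite (le_trans (ler_norm k))// lerDl.
pose h x := f (c x) + K * x.
have h_nd : {homo h : x y / x <= y}.
  move=> x y xy; have := fK _ _ xy; rewrite ler_norml => /andP[+ _].
  have /andP[_ cxy] := c_nd _ _ xy.
  have := ler_wpM2l (ltW K0) cxy; rewrite /h; lra.
have h_lip x y : x <= y -> h y - h x <= (2 * K) * (y - x).
  move=> xy; have := fK _ _ xy; rewrite ler_norml => /andP[_ +].
  have /andP[_ cxy] := c_nd _ _ xy.
  have := ler_wpM2l (ltW K0) cxy; rewrite /h; lra.
have h_rc : right_continuous h.
  apply: right_continuousW => x; apply/cvgrPdist_le => e e0.
  near=> y.
  suff : `|h x - h y| <= 2 * K * `|x - y|.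
    move=> /le_trans; apply.
    rewrite -ler_pdivlMl ?mulr_gt0//; near: y.
    by apply: cvgr_dist_le => //; rewrite mulr_gt0// invr_gt0 mulr_gt0.
  have [xy|/ltW yx] := leP x y.
    by rewrite distrC [X in _ * X]distrC !ger0_norm ?subr_ge0// ?h_nd// h_lip.
  by rewrite !ger0_norm ?subr_ge0// ?h_nd// h_lip.
pose H : cumulative R R := HB.pack h (isCumulative.Build R _ R h h_nd h_rc).
have := @derivable_ae_cumulative H (2 * K) a b (mulr_gt0 (ltr0n R 2) K0) ab h_lip.
move=> aeH; apply: (@filterS _ _ (ae_filter_ringOfSetsType mu) _ _ _ aeH) => x Hx xab.
have {Hx}dh := Hx xab.
apply: (@near_eq_derivable _ _ _ (fun y => h y - K * y)).
  near=> y; rewrite /h addrK cid//; apply: subset_itv_oo_cc.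
  by near: y; exact: near_in_itvoo.
by apply: derivableB => //; apply: derivableM => //; exact: derivable_cst.
Unshelve. all: by end_near. Qed.

Lemma derivable_ae_lipschitz_mx (m n : nat) (X : R -> 'M[R]_(m, n)) (a b k : R) :
  a < b -> k.-lipschitz_(`[a, b]) X ->
  {ae mu, forall t, t \in `]a, b[ -> derivable X t 1}.
Proof.
move=> ab Xlip.
have entry_ae (p : 'I_m * 'I_n) :
    {ae mu, forall t, t \in `]a, b[ -> derivable (fun s => X s p.1 p.2) t 1}.
  apply: (@derivable_ae_lipschitz _ a b k ab) => x y xab yab.
  have /= := Xlip (x, y) (conj xab yab); apply: le_trans.
  rewrite [leRHS]/Num.Def.normr/= mx_normrE.
  by apply: le_trans; last exact: (le_bigmax _ _ p); rewrite !mxE.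
have /= all_ae := @filter_forall _ _ _ _ (ae_filter_ringOfSetsType mu) entry_ae.
apply: (@filterS _ _ (ae_filter_ringOfSetsType mu) _ _ _ all_ae) => t dX tab.
by apply/derivable_mxP => i j; exact: (dX (i, j) tab).
Qed.

End Rademacher.

(** * The vectors of the regular hexagon *)

Section Trig.
Context {R : realType}.

(** With [c = cos (pi / 3)], the triple-angle formula for [cos pi = - 1] reads
    [(c + 1) (2 c - 1)^2 = 0], and [c] is positive. *)
Lemma cos_pi3 : cos (pi / 3 : R) = 1 / 2.
Proof.
have c0 : 0 < cos (pi / 3 : R).
  by apply: cos_gt0_pihalf; have := @pi_gt0 R; lra.
have e : cos (pi / 3 + (pi / 3 + pi / 3) : R) = -1.
  by rewrite -cospi; congr cos; field.
move: e; rewrite cosD cosD sinD.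
have := cos2Dsin2 (pi / 3 : R).
set c := cos _ in c0 *; set s := sin _ => e1 e2.
have : (c + 1) * (2 * c - 1) ^+ 2 = 0.
  have -> : (c + 1) * (2 * c - 1) ^+ 2 = 4 * c ^+ 3 - 3 * c + 1 by ring.
  have s2 : s ^+ 2 = 1 - c ^+ 2 by rewrite -e1; ring.
  move: e2; have -> : c * (c * c - s * s) - s * (s * c + c * s) =
    c ^+ 3 - 3 * c * s ^+ 2 by ring.
  rewrite s2 => e2; have -> : 4 * c ^+ 3 - 3 * c = -1 by rewrite -e2; ring.
  by rewrite addNr.
move/eqP; rewrite mulf_eq0 expf_eq0/= => /orP[/eqP|/eqP]; lra.
Qed.

Lemma sin_pi3 : sin (pi / 3 : R) = Num.sqrt 3 / 2.
Proof.
have s0 : 0 < sin (pi / 3 : R).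
  by apply: sin_gt0_pi; have := @pi_gt0 R; lra.
have := cos2Dsin2 (pi / 3 : R); rewrite cos_pi3 => e.
apply/eqP; rewrite -(@eqrXn2 _ 2) ?divr_ge0 ?sqrtr_ge0 ?ltW//.
rewrite exprMn sqr_sqrtr//; apply/eqP; lra.
Qed.

Lemma e_star0 : e_star R 0 = \col_i if i == 0 then 1 else 0.
Proof. by apply/colP => i; rewrite !mxE mulr0 mul0r cos0 sin0. Qed.

Lemma e_star2 : e_star R 2 = \col_i if i == 0 then - (1 / 2) else Num.sqrt 3 / 2.
Proof.
apply/colP => i; rewrite !mxE.
have -> : (pi * 2 / 3 : R) = - (pi / 3) + pi by field.
by rewrite cosDpi sinDpi cosN sinN opprK cos_pi3 sin_pi3.
Qed.

Lemma e_star4 : e_star R 4 = \col_i if i == 0 then - (1 / 2) else - (Num.sqrt 3 / 2).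
Proof.
apply/colP => i; rewrite !mxE.
have -> : (pi * 4 / 3 : R) = pi / 3 + pi by field.
by rewrite cosDpi sinDpi cos_pi3 sin_pi3.
Qed.
End Trig.

(** * Algebra of trace-free matrices of order two *)

Section TwoByTwo.
Context {R : comNzRingType}.

Lemma big_ord2 (F : 'I_2 -> R) : \sum_i F i = F 0 + F 1.
Proof. by rewrite !big_ord_recl big_ord0 addr0; congr (_ + F _); exact/val_inj. Qed.

Lemma matrix2P (A B : 'M[R]_2) :
  A 0 0 = B 0 0 -> A 0 1 = B 0 1 -> A 1 0 = B 1 0 -> A 1 1 = B 1 1 -> A = B.
Proof.
move=> e00 e01 e10 e11; apply/matrixP => i j.
have I2 (k : 'I_2) : k = 0 \/ k = 1.
  by case: k => [[|[|//]] ?]; [left|right]; exact/val_inj.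
by have [->|->] := I2 i; have [->|->] := I2 j.
Qed.

Lemma sl2_entry11 (A : 'M[R]_2) : \tr A = 0 -> A 1 1 = - A 0 0.
Proof. by rewrite /mxtrace big_ord2 addrC => /eqP; rewrite addr_eq0 => /eqP. Qed.

(** The polarized form of the Cayley-Hamilton identity [A^2 = - det A]. *)
Lemma sl2_anticomm (A B : 'M[R]_2) : \tr A = 0 -> \tr B = 0 ->
  A *m B + B *m A = (\tr (A *m B))%:M.
Proof.
move=> /sl2_entry11 A11 /sl2_entry11 B11.
by apply: matrix2P; rewrite !mxE /mxtrace !big_ord2 !mxE !big_ord2 /= ?A11 ?B11; ring.
Qed.

Lemma det_mx22 (A : 'M[R]_2) : \det A = A 0 0 * A 1 1 - A 0 1 * A 1 0.
Proof.
rewrite (expand_det_row _ 0) big_ord2 /cofactor !det_mx11 !mxE /=.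
have -> : lift 0 0 = 1 :> 'I_2 by exact/val_inj.
have -> : lift 1 0 = 0 :> 'I_2 by exact/val_inj.
by ring.
Qed.

Lemma sl2_sqr (A : 'M[R]_2) : \tr A = 0 -> A *m A = - (\det A)%:M.
Proof.
move=> /sl2_entry11 A11; rewrite det_mx22.
by apply: matrix2P; rewrite !mxE !big_ord2 /= ?A11; ring.
Qed.

End TwoByTwo.

(** * The control matrix *)

Section Control.
Context {R : realType}.
Implicit Types (X Y : 'M[R]_2).

Lemma control_matrixZ (u : nat -> R) (r : R) :
  control_matrix (fun j => u j / r) = r^-1 *: control_matrix u.
Proof. by apply: matrix2P; rewrite !mxE /=; ring. Qed.

Lemma wedge_sl2 (p : 'cV[R]_2) Y : \tr Y = 0 ->
  wedge p (Y *m p) = Y 1 0 * p 0 0 ^+ 2 - 2 * Y 0 0 * p 0 0 * p 1 0 - Y 0 1 * p 1 0 ^+ 2.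
Proof.
move=> /sl2_entry11 Y11; rewrite /wedge det_mx22.
have E0 i : (row_mx p (Y *m p) : 'M[R]_2) i 0 = p i 0.
  by rewrite mxE; case: splitP => [k _|k //]; rewrite ord1.
have E1 i : (row_mx p (Y *m p) : 'M[R]_2) i 1 = (Y *m p) i 0.
  by rewrite mxE; case: splitP => [[[]]//|k _]; rewrite ord1.
by rewrite !E0 !E1 !mxE !big_ord2 Y11; ring.
Qed.

(** A trace-free matrix is recovered from the values of its quadratic form at
    three pairwise independent vectors. *)
Lemma control_matrix_wedge Y : \tr Y = 0 ->
  control_matrix (fun j => wedge (e_star R (2 * j)%N) (Y *m e_star R (2 * j)%N)) = Y.
Proof.
move=> Y0.
have s3 : Num.sqrt 3 ^+ 2 = 3 :> R by rewrite sqr_sqrtr.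
have s0 : Num.sqrt 3 != 0 :> R by rewrite sqrtr_eq0 -ltNge.
rewrite /control_matrix !wedge_sl2// muln0 muln1 (_ : (2 * 2 = 4)%N)//.
rewrite e_star0 e_star2 e_star4.
apply: matrix2P; rewrite !mxE /= ?(sl2_entry11 Y0).
- by field.
- by rewrite !sqrrN (exprMn _ (Num.sqrt 3)) s3; field.
- by ring.
- by field.
Qed.

(** The hypotheses make [X] and [X'] anticommute and [X] square to [- I], so
    that [X X' X = X']; hence [pairing Z X = - 2 / r] and
    [bracket Z X = - (2 / r) X']. *)
Lemma control_dynamics X X' (r : R) :
  let Z := r^-1 *: (X - X *m X') in
  r != 0 -> \tr X = 0 -> \det X = 1 -> \tr X' = 0 -> \tr (X *m X') = 0 ->
  pairing Z X != 0 /\ X' = (pairing Z X)^-1 *: bracket Z X.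
Proof.
move=> Z r0 X0 dX X'0 XX'.
have sqX : X *m X = - 1%:M by rewrite sl2_sqr// dX.
have anti : X' *m X = - (X *m X').
  by apply/eqP; rewrite -addr_eq0 addrC sl2_anticomm// XX' raddf0.
have XX'X : X *m X' *m X = X'.
  by rewrite -mulmxA anti mulmxN mulmxA sqX mulNmx mul1mx opprK.
have pE : pairing Z X = - 2 / r.
  rewrite /pairing /Z -scalemxAl mxtraceZ mulmxBl XX'X sqX.
  by rewrite !raddfB/= raddfN/= mxtrace1 X'0; ring.
have bE : bracket Z X = (- 2 / r) *: X'.
  have ZX : (X - X *m X') *m X = - 1%:M - X' by rewrite mulmxBl XX'X sqX.
  have XZ : X *m (X - X *m X') = - 1%:M + X'.
    by rewrite mulmxBr mulmxA sqX mulNmx mul1mx opprK.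
  rewrite /bracket /Z -scalemxAl -scalemxAr ZX XZ -scalerBr mulrC -scalerA.
  by rewrite opprD addrACA subrr add0r -opprD -mulr2n scaleNr scaler_nat.
split; first by rewrite pE mulf_neq0 ?invr_eq0// oppr_eq0.
by rewrite pE bE scalerA mulVf ?scale1r// mulf_neq0 ?invr_eq0// oppr_eq0.
Qed.

Lemma is_derive_near_cst (f : R -> R) (t c df : R) :
  is_derive t 1 f df -> (\forall s \near t, f s = c) -> df = 0.
Proof.
move=> fdf fc; rewrite -(@derive_val _ _ _ _ _ _ _ fdf).
rewrite (@near_eq_derive _ _ _ f (cst c)) ?derive_cst//.
Qed.

(** Both equations are derivatives of constants: of the trace, and of the
    determinant, whose derivative on [sl2] is [- tr (X X')]. *)
Lemma sl2_curve_derive (X : R -> 'M[R]_2) (t : R) :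
  derivable X t 1 ->
  (\forall s \near t, \tr (X s) = 0) -> (\forall s \near t, \det (X s) = 1) ->
  \tr (derive1 X t) = 0 /\ \tr (X t *m derive1 X t) = 0.
Proof.
move=> dX trX detX.
have dXij i j : is_derive t (1 : R) (fun s => X s i j) (derive1 X t i j).
  rewrite derive1E derive_mx// mxE; apply/derivableP.
  exact: (derivable_mxP _ _ _).1.
have tr' : \tr (derive1 X t) = 0.
  have d := is_deriveD (dXij 0 0) (dXij 1 1).
  rewrite /mxtrace big_ord2; apply: (@is_derive_near_cst _ t 0 _ d).
  by apply: filterS trX => s; rewrite /mxtrace big_ord2.
split=> //.
have d := is_deriveB (is_deriveM (dXij 0 0) (dXij 1 1))
                     (is_deriveM (dXij 0 1) (dXij 1 0)).
have := is_derive_near_cst d.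
have Xt := sl2_entry11 (nbhs_singleton trX).
have X't := sl2_entry11 tr'.
move=> /(_ 1) d0; rewrite /mxtrace big_ord2 !mxE !big_ord2 Xt X't.
rewrite -[RHS]oppr0 -d0; last by apply: filterS detX => s; rewrite det_mx22.
by rewrite Xt X't /GRing.scale/=; ring.
Qed.

(** Since [X^2 = - I], the matrix [X + X^-1 X'] of the curvatures equals
    [X - X X'], and the hypotheses make it trace-free. *)
Lemma control_matrix_control (X : R -> 'M[R]_2) (t : R) :
  \tr (X t) = 0 -> \det (X t) = 1 -> \tr (X t *m derive1 X t) = 0 ->
  control_matrix (control X t) =
  (total_curvature X t)^-1 *: (X t - X t *m derive1 X t).
Proof.
move=> X0 dX XX'.
rewrite /control control_matrixZ -[in RHS](@control_matrix_wedge (_ - _)); last first.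
  by rewrite raddfB/= X0 XX' subr0.
have sqX : X t *m X t = - 1%:M by rewrite sl2_sqr// dX.
have invX : invmx (X t) = - X t.
  have uX : X t \in unitmx by rewrite unitmxE dX unitr1.
  by apply: (can_inj (mulKmx uX)); rewrite mulmxV// mulmxN sqX opprK.
by congr (_ *: control_matrix _); apply/funext => j; rewrite /curvature invX mulNmx.
Qed.

End Control.

(** * The control-dependent dynamics *)

Theorem theorem2p2p15 (R : realType) (tf : R) (g dg X : R -> 'M[R]_2)
  (htf : 0 < tf)
  (hgSL2 : forall t, t \in `[0, tf] -> SL2 (g t))
  (hXsl2 : forall t, t \in `[0, tf] -> sl2 (X t))
  (hgC1 : C1_on `[0, tf] g dg)
  (hgX : forall t, t \in `[0, tf] -> dg t = g t *m X t)
  (hXlip : exists k : R, k.-lipschitz_(`[0, tf]) X)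
  (hdetX : forall t, t \in `[0, tf] -> \det (X t) = 1)
  (hstar : forall t, t \in `[0, tf] -> star_conditions (X t))
  (hcurv : {ae @lebesgue_measure R, forall t, t \in `[0, tf] ->
             forall j : 'I_3, 0 <= curvature X j t})
  (hcurv_pos : {ae @lebesgue_measure R, forall t, t \in `[0, tf] ->
             0 < total_curvature X t}) :
  {ae @lebesgue_measure R, forall t, t \in `[0, tf] ->
    let Z := control_matrix (control X t) in
    [/\ derivable X t 1,
        pairing Z (X t) != 0 &
        derive1 X t = (pairing Z (X t))^-1 *: bracket Z (X t)]}.
Proof.
have [k Xlip] := hXlip.
(* At an endpoint, the values of [X] outside of the interval could prevent the
   two-sided derivative from existing; these two points are discarded. *)
have ae_neq (r : R) : {ae @lebesgue_measure R, forall t : R, t != r}.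
  exists [set r]; split; [exact: measurable_set1|exact: lebesgue_measure_set1|].
  by move=> t /= /negP; rewrite negbK => /eqP.
have aeF := ae_filter_ringOfSetsType (@lebesgue_measure R).
have good := @filterI _ _ aeF _ _ (@filterI _ _ aeF _ _ (ae_neq 0) (ae_neq tf))
  (@filterI _ _ aeF _ _ (derivable_ae_lipschitz_mx htf Xlip) hcurv_pos).
apply: (@filterS _ _ aeF _ _ _ good) => t [[t0 ttf] [dX v_gt0]] tI /=.
have toI : t \in `]0, tf[.
  move: tI; rewrite !in_itv/= => /andP[t_ge0 t_le].
  by rewrite lt_neqAle eq_sym t0 t_ge0 lt_neqAle ttf t_le.
have {}dX := dX toI.
have near_I : \forall s \near t, s \in `[0, tf].
  by near=> s; apply: subset_itv_oo_cc; near: s; exact: near_in_itvoo.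
have [trX' trXX'] : \tr (derive1 X t) = 0 /\ \tr (X t *m derive1 X t) = 0.
  by apply: sl2_curve_derive => //; apply: filterS near_I => s sI;
    [exact: hXsl2|exact: hdetX].
have ZE : control_matrix (control X t) =
    (total_curvature X t)^-1 *: (X t - X t *m derive1 X t).
  by apply: control_matrix_control; [exact: hXsl2|exact: hdetX|].
have v_neq0 : total_curvature X t != 0 by rewrite gt_eqF// v_gt0.
rewrite ZE; have [pairing_neq0 X'E] := @control_dynamics _ (X t) (derive1 X t) _ v_neq0
  (hXsl2 t tI) (hdetX t tI) trX' trXX'.
by split.
Unshelve. all: by end_near. Qed.
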